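(* Consider the optimization problem $$\underset{x\in\mathbb{R}^{n_\ell}}{\mathrm{minimize}}\ f_{\alpha,\epsilon}(x)\quad\text{subject to}\quad \mathcal{I}x\le \chi,\qquad \mathcal{I}(Q_{\rm crit}x-Q_L)\le\varphi, \qquad (\ast)$$ and assume that Slater's condition holds, namely that a strictly feasible point for $(\ast)$ exists, i.e. some $x\in\mathbb{R}^{n_\ell}$ with $\mathcal{I}x<\chi$ and $\mathcal{I}(Q_{\rm crit}x-Q_L)<\varphi$ (componentwise strict inequalities). Then there exists $\overline{\rho}>0$ such that for every step size $\rho$ with $0<\rho\le\overline{\rho}$ and all initial multipliers $\lambda(0),\mu(0)\in\mathbb{R}^{2n_\ell}$, the dual ascent algorithm $$x(t+1)=\underset{x\in\mathbb{R}^{n_\ell}}{\mathrm{argmin}}\ \mathcal{L}(x,\lambda(t),\mu(t)),$$ $$\lambda(t+1)=\left[\lambda(t)+\rho\left(\mathcal{I}x(t+1)-\chi\right)\right]^+,$$ $$\mu(t+1)=\left[\mu(t)+\rho\left(\mathcal{I}(Q_{\rm crit}x(t+1)-Q_L)-\varphi\right)\right]^+,$$ for $t=0,1,2,\dots$, converges to the optimal solution of $(\ast)$, i.e. $x(t)$ converges, as $t\to\infty$, to the optimal solution of $(\ast)$.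
   Context: Notation: $n_\ell\ge 1$ is an integer (number of load buses); $[y]$ applied to a vector $y$ in the definitions of $Q_{\rm crit}$, $x_{\min}$, $x_{\max}$ below denotes the diagonal matrix with diagonal entries $y_i$; $\mathbf{1}$ is the all-ones vector; inequalities between vectors are componentwise; $[\cdot]^+$ denotes the componentwise projection on the nonnegative orthant ($[a]^+=a$ if $a>0$ and $0$ otherwise). Cost: for parameters $\alpha>0$ and $0<\epsilon\le 1$, $$f_{\alpha,\epsilon}(x)=\sum_{i=1}^{n_\ell}\exp\left(\alpha|x_i|^{1+\epsilon}\right),\qquad x\in\mathbb{R}^{n_\ell}.$$ Network data: the set of buses of a power network is partitioned into $n_\ell$ load buses and $n_g$ generator buses. $B\in\mathbb{R}^{(n_\ell+n_g)\times(n_\ell+n_g)}$ is the real symmetric susceptance matrix, written in blocks as $B=\begin{pmatrix} B_{LL} & B_{LG} \\ B_{GL} & B_{GG} \end{pmatrix}$. The block $B_{LL}\in\mathbb{R}^{n_\ell\times n_\ell}$ is a Metzler matrix (nonnegative off-diagonal entries) all of whose eigenvalues have negative real part, and the graph associated with $B_{LL}$ is connected. $V_G\in\mathbb{R}^{n_g}$ is the vector of generator voltage magnitudes, $V_L^*=-B_{LL}^{-1}B_{LG}V_G\in\mathbb{R}^{n_\ell}$ is the vector of open-circuit voltages (all its entries are nonzero, so that $[V_L^*]$ is invertible), and the critical load matrix is $$Q_{\rm crit}=\tfrac14[V_L^*]B_{LL}[V_L^*].$$ $Q_L\in\mathbb{R}^{n_\ell}$ is the vector of reactive power loads, $q_{\min},q_{\max}\in\mathbb{R}^{n_\ell}$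 are given injection capacity limits, $V_N>0$ is a reference voltage, and $\eta>0$ is the percentage deviation allowed from it. Constraint data: $$x_{\min}=4\left(V_N(1-\eta)[V_L^*]^{-1}\mathbf{1}-\mathbf{1}\right),\qquad x_{\max}=4\left(V_N(1+\eta)[V_L^*]^{-1}\mathbf{1}-\mathbf{1}\right),$$ $$\mathcal{I}=\begin{bmatrix} I \\ -I \end{bmatrix}\in\mathbb{R}^{2n_\ell\times n_\ell},\qquad \chi=\begin{bmatrix} x_{\max} \\ -x_{\min} \end{bmatrix},\qquad \varphi=\begin{bmatrix} q_{\max} \\ -q_{\min} \end{bmatrix},$$ where $I$ is the $n_\ell\times n_\ell$ identity matrix. Lagrangian: for $x\in\mathbb{R}^{n_\ell}$ and $\lambda,\mu\in\mathbb{R}^{2n_\ell}$, $$\mathcal{L}(x,\lambda,\mu)=f_{\alpha,\epsilon}(x)+\lambda^T(\mathcal{I}x-\chi)+\mu^T\left(\mathcal{I}(Q_{\rm crit}x-Q_L)-\varphi\right).$$ *)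

(* Defs.v *)
From mathcomp Require Import all_boot all_order all_algebra.
From mathcomp Require Import all_classical all_reals all_analysis.
From mathcomp Require Import complex.

Set Implicit Arguments.
Unset Strict Implicit.
Unset Printing Implicit Defensive.

Import Order.TTheory GRing.Theory Num.Theory.
Import numFieldNormedType.Exports.

Local Open Scope classical_set_scope.
Local Open Scope ring_scope.

Definition vec_le (R : realType) (n : nat) (u v : 'cV[R]_n) : Prop :=
  forall i, u i 0 <= v i 0.

Definition vec_lt (R : realType) (n : nat) (u v : 'cV[R]_n) : Prop :=
  forall i, u i 0 < v i 0.

Definition pos_part (R : realType) (n : nat) (u : 'cV[R]_n) : 'cV[R]_n :=
  map_mx (Num.max 0) u.

Definition metzler (R : realType) (n : nat) (A : 'M[R]_n) : Prop :=
  forall i j, i != j -> 0 <= A i j.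

(* The spectrum is taken over the complex numbers [R[i]]. *)
Definition hurwitz (R : realType) (n : nat) (A : 'M[R]_n) : Prop :=
  forall z : R[i], eigenvalue (map_mx (real_complex R) A) z -> complex.Re z < 0.

(* The graph of [A] has an edge from [i] to [j] when [i != j] and
   [A i j != 0]; it is undirected when [A] is symmetric. *)
Definition graph_connected (R : realType) (n : nat) (A : 'M[R]_n) : Prop :=
  forall i j, connect [rel k l | (k != l) && (A k l != 0)] i j.

Definition argmin (R : realType) (T : Type) (D : set T) (F : T -> R) : set T :=
  [set x | D x /\ forall y, D y -> F x <= F y].

Definition cost (R : realType) (n : nat) (alpha eps : R) (x : 'cV[R]_n) : R :=
  \sum_(i < n) expR (alpha * `|x i 0| `^ (1 + eps)).

(* The rows (columns) of [B] are ordered with the [nl] load buses first and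
   the [ng] generator buses last. *)
Definition B_LL (R : realType) (nl ng : nat) (B : 'M[R]_(nl + ng)) : 'M[R]_nl :=
  ulsubmx B.

Definition B_LG (R : realType) (nl ng : nat) (B : 'M[R]_(nl + ng)) :
  'M[R]_(nl, ng) := ursubmx B.

Definition open_circuit_voltage (R : realType) (nl ng : nat)
  (B : 'M[R]_(nl + ng)) (VG : 'cV[R]_ng) : 'cV[R]_nl :=
  - (invmx (B_LL B) *m B_LG B *m VG).

Definition diag (R : realType) (n : nat) (v : 'cV[R]_n) : 'M[R]_n :=
  diag_mx v^T.

Definition Q_crit (R : realType) (nl ng : nat)
  (B : 'M[R]_(nl + ng)) (VG : 'cV[R]_ng) : 'M[R]_nl :=
  4^-1 *: (diag (open_circuit_voltage B VG) *m B_LL B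
             *m diag (open_circuit_voltage B VG)).

Definition x_min (R : realType) (nl ng : nat)
  (B : 'M[R]_(nl + ng)) (VG : 'cV[R]_ng) (VN eta : R) : 'cV[R]_nl :=
  4 *: ((VN * (1 - eta)) *: (invmx (diag (open_circuit_voltage B VG))
                               *m const_mx 1) - const_mx 1).

Definition x_max (R : realType) (nl ng : nat)
  (B : 'M[R]_(nl + ng)) (VG : 'cV[R]_ng) (VN eta : R) : 'cV[R]_nl :=
  4 *: ((VN * (1 + eta)) *: (invmx (diag (open_circuit_voltage B VG))
                               *m const_mx 1) - const_mx 1).

Definition stackI (R : realType) (n : nat) : 'M[R]_(n + n, n) :=
  col_mx 1%:M (- 1%:M).

Definition chi (R : realType) (nl ng : nat)
  (B : 'M[R]_(nl + ng)) (VG : 'cV[R]_ng) (VN eta : R) : 'cV[R]_(nl + nl) :=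
  col_mx (x_max B VG VN eta) (- x_min B VG VN eta).

Definition phi (R : realType) (n : nat) (qmin qmax : 'cV[R]_n) :
  'cV[R]_(n + n) := col_mx qmax (- qmin).

(* In the definitions below [Q], [QL], [c] and [p] stand for the critical load
   matrix, the reactive loads, and the vectors [chi] and [phi]. *)
Definition feasible (R : realType) (n : nat) (Q : 'M[R]_n) (QL : 'cV[R]_n)
  (c p : 'cV[R]_(n + n)) : set 'cV[R]_n :=
  [set x | vec_le (stackI R n *m x) c
           /\ vec_le (stackI R n *m (Q *m x - QL)) p].

Definition strictly_feasible (R : realType) (n : nat) (Q : 'M[R]_n)
  (QL : 'cV[R]_n) (c p : 'cV[R]_(n + n)) : set 'cV[R]_n :=
  [set x | vec_lt (stackI R n *m x) c
           /\ vec_lt (stackI R n *m (Q *m x - QL)) p].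

Definition lagrangian (R : realType) (n : nat) (alpha eps : R) (Q : 'M[R]_n)
  (QL : 'cV[R]_n) (c p : 'cV[R]_(n + n))
  (lambda mu : 'cV[R]_(n + n)) (x : 'cV[R]_n) : R :=
  cost alpha eps x
  + (lambda^T *m (stackI R n *m x - c)) 0 0
  + (mu^T *m (stackI R n *m (Q *m x - QL) - p)) 0 0.

(* The entry [x 0] is unconstrained: the algorithm is initialised by the
   multipliers only. *)
Definition dual_ascent (R : realType) (n : nat) (alpha eps : R) (Q : 'M[R]_n)
  (QL : 'cV[R]_n) (c p : 'cV[R]_(n + n)) (rho : R)
  (x : nat -> 'cV[R]_n) (lambda mu : nat -> 'cV[R]_(n + n)) : Prop :=
  forall t : nat,
    [/\ argmin [set: 'cV[R]_n]
          (lagrangian alpha eps Q QL c p (lambda t) (mu t)) = [set x t.+1],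
        lambda t.+1 = pos_part (lambda t + rho *: (stackI R n *m x t.+1 - c))
      & mu t.+1 = pos_part
          (mu t + rho *: (stackI R n *m (Q *m x t.+1 - QL) - p))].

(* Main.v *)
Require Import Defs.
From mathcomp Require Import all_boot all_order all_algebra.
From mathcomp Require Import all_classical all_reals all_analysis.
From mathcomp Require Import complex.
From mathcomp Require Import ring lra.

Set Implicit Arguments.
Unset Strict Implicit.
Unset Printing Implicit Defensive.

Import Order.TTheory GRing.Theory Num.Theory.
Import numFieldNormedType.Exports.

Local Open Scope classical_set_scope.
Local Open Scope ring_scope.

(** The two families of inequalities form a single system [A x <= b], and the
    two multipliers a single vector [nu]; the Lagrangian is then
    [L nu x = f x + nu . (A x - b)], and dual ascent is projected gradient
    ascent on the dual function [d nu = min_x (L nu x)].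

    Everything rests on the strong convexity of the cost, used in midpoint form:
    [f ((x + y) / 2) + c |x - y|^2 <= (f x + f y) / 2]
    ([scalar_cost_strongly_convex], [cost_strongly_convex]).  If [x] minimizes
    [L nu], comparing it with the midpoint of [x] and [y] gives
    [L nu x + 2 c |y - x|^2 <= L nu y] ([quadratic_growth]).  Adding two such
    inequalities, for minimizers [x] of [L nu] and [x'] of [L nu'], yields
    [(nu' - nu) . A (x' - x) <= - 4 c |x' - x|^2] ([minimizers_monotone]); in
    particular the minimizer is a Lipschitz function of the multiplier
    ([minimizer_lipschitz]).

    Slater's condition makes [d] tend to minus infinity on the nonnegative
    orthant, so [d] has a maximizer [nu_opt] there ([exists_dual_maximizer]).
    Let [x_opt] minimize [L nu_opt].  Since the minimizer is a Lipschitz function of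
    [nu], [d nu] agrees with [d nu_opt + (nu - nu_opt) . (A x_opt - b)] up to a
    quadratic error, and the maximality of [nu_opt] yields the
    Karush-Kuhn-Tucker conditions for [x_opt] and [nu_opt]
    ([exists_saddle_point]) without any separation theorem.  Quadratic
    growth at [nu_opt] then shows that [x_opt] is the only optimal point
    ([saddle_point_optimal]).

    For the convergence, [nu_opt] is a fixed point of the multiplier update.  The
    projection on the orthant is nonexpansive, so monotonicity gives
    [|nu(t+1) - nu_opt|^2
       <= |nu(t) - nu_opt|^2 - (8 c rho - rho^2 K) |x(t+1) - x_opt|^2]
    where [|A v|^2 <= K |v|^2].  As soon as [rho <= 4 c / K], the squared
    distance to [nu_opt] decreases by at least [4 c rho |x(t+1) - x_opt|^2],
    which must therefore tend to zero ([dual_ascent_cvg]). *)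

(** * Strong convexity of the scalar cost *)

(** The slopes of [f] over the two halves of [a, b] are values of [f1] at two
    increasing points, and [f1] is nondecreasing.  Differentiability is required
    only inside the interval, so that the lemma applies up to a point where the
    second derivative blows up. *)
Lemma midpoint_convex_of_derive2 (R : realType) (f f1 f2 : R -> R) (a b : R) :
  a <= b -> {within `[a, b], continuous f} ->
  (forall x, a < x -> x < b -> is_derive x 1 f (f1 x)) ->
  (forall x, a < x -> x < b -> is_derive x 1 f1 (f2 x)) ->
  (forall x, a < x -> x < b -> 0 <= f2 x) ->
  f ((a + b) / 2) <= (f a + f b) / 2.
Proof.
rewrite le_eqVlt => /orP[/eqP <-|ab] cf df df1 f2_ge0.
  by rewrite (_ : (a + a) / 2 = a); lra.
pose m := (a + b) / 2.
have am : a < m by rewrite /m; lra.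
have mb : m < b by rewrite /m; lra.
have [c1 /[!in_itv]/= /andP[ac1 c1m] e1] : exists2 c, c \in `]a, m[ &
    f m - f a = f1 c * (m - a).
  apply: MVT => // [x|].
    by rewrite in_itv/= => /andP[ax xm]; apply: df => //; lra.
  apply: continuous_subspaceW cf => x /=; rewrite !in_itv/=.
  by move=> /andP[-> xm] /=; lra.
have [c2 /[!in_itv]/= /andP[mc2 c2b] e2] : exists2 c, c \in `]m, b[ &
    f b - f m = f1 c * (b - m).
  apply: MVT => // [x|].
    by rewrite in_itv/= => /andP[ax xm]; apply: df => //; lra.
  apply: continuous_subspaceW cf => x /=; rewrite !in_itv/=.
  by move=> /andP[mx ->]; rewrite andbT; lra.
have c12 : c1 < c2 by lra.
have [d /[!in_itv]/= /andP[c1d dc2] e3] : exists2 d, d \in `]c1, c2[ &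
    f1 c2 - f1 c1 = f2 d * (c2 - c1).
  apply: MVT => // [x|].
    by rewrite in_itv/= => /andP[c1x xc2]; apply: df1; lra.
  apply: derivable_within_continuous => x.
  rewrite in_itv/= => /andP[c1x xc2].
  by apply: (@ex_derive _ _ _ _ _ _ _ (df1 x _ _)); lra.
have f2d : 0 <= f2 d by apply: f2_ge0; lra.
have f1le : f1 c1 <= f1 c2 by rewrite -subr_ge0 e3 mulr_ge0// subr_ge0 ltW.
have e4 : b - m = m - a by rewrite /m; field.
have : f1 c1 * (m - a) <= f1 c2 * (m - a) by rewrite ler_wpM2r// subr_ge0 ltW.
by rewrite -/m -e1 -e4 -e2; lra.
Qed.

Section scalar_cost.
Context {R : realType}.
Variables (alpha eps : R).
Hypotheses (alpha_gt0 : 0 < alpha) (eps_gt0 : 0 < eps) (eps_le1 : eps <= 1).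

Let E (r : R) : R := expR (alpha * r `^ (1 + eps)).

Lemma continuous_norm_powR : continuous (fun s : R => `|s| `^ (1 + eps)).
Proof.
have p_neq0 : 1 + eps != 0 by rewrite gt_eqF// addr_gt0.
move=> s; have [->|s0] := eqVneq s 0.
  rewrite /continuous_at normr0 powR0//.
  apply: (@squeeze_cvgr _ _ _ _ (cst 0) (fun s => `|s|)); last 2 first.
  - exact: cvg_cst.
  - by rewrite -[X in _ --> X](@normr0 R R); exact: norm_continuous.
  near=> r; rewrite powR_ge0/=.
  have r1 : `|r| <= 1.
    near: r; apply/nbhs_ballP; exists 1 => //= r.
    by rewrite /ball/= sub0r normrN => /ltW.
  have [->|r0] := eqVneq r 0; first by rewrite normr0 powR0.
  by rewrite ge1r_powR ?normr_gt0 ?r0 ?lerDl ?ltW//=.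
apply: (@continuous_comp _ _ _ (fun s : R => `|s|) (@powR R ^~ (1 + eps))).
  exact: norm_continuous.
apply: differentiable_continuous; apply/derivable1_diffP.
by apply: derivable_powR; rewrite in_itv/= andbT normr_gt0.
Unshelve. all: end_near. Qed.

Lemma continuous_scalar_cost :
  continuous (fun s : R => expR (alpha * `|s| `^ (1 + eps))).
Proof.
move=> s; apply: continuous_comp; last exact: continuous_expR.
by apply: cvgMr; exact: continuous_norm_powR.
Qed.

(** Small enough for [E r - k r^2] to be convex and nondecreasing on the
    half-line.  The second derivative of [E] has two summands: the first bound
    comes from the one that dominates for [r <= 1], the second bound from the one
    that dominates for [1 <= r]. *)
Let k : R := Num.min (alpha * (1 + eps) * eps / 2) (alpha ^+ 2 / 2).

Let k_gt0 : 0 < k.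
Proof. by rewrite lt_min !divr_gt0 ?mulr_gt0 ?exprn_gt0// addr_gt0. Qed.

Let h (r : R) : R := E r - k * r ^+ 2.
Let f1 (r : R) : R := alpha * (1 + eps) * r `^ eps * E r - 2 * k * r.
Let f2 (r : R) : R :=
  alpha * (1 + eps) * eps * r `^ (eps - 1) * E r
  + (alpha * (1 + eps) * r `^ eps) ^+ 2 * E r - 2 * k.

Let deriveE (r : R) : 0 < r ->
  is_derive r 1 E (alpha * (1 + eps) * r `^ eps * E r).
Proof.
move=> r0.
have dp := is_derive1_powR (1 + eps) r0.
have dm : is_derive r 1 (fun r => alpha * r `^ (1 + eps))
    (alpha * ((1 + eps) * r `^ (1 + eps - 1))) := is_deriveZ alpha dp.
apply: (is_derive_eq (is_derive1_comp (is_derive_expR _) dm)).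
by rewrite (_ : 1 + eps - 1 = eps) /E; ring.
Qed.

Let derive_h (r : R) : 0 < r -> is_derive r 1 h (f1 r).
Proof.
move=> r0; have dE := deriveE r0.
have dX : is_derive r 1 (fun r : R => r ^+ 2) (2 * r).
  rewrite (_ : (fun _ => _) = id * id); last exact/funext.
  have dM := is_deriveM (is_derive_id r 1) (is_derive_id r 1).
  by apply: (is_derive_eq dM); rewrite /GRing.scale/=; ring.
apply: (is_derive_eq (is_deriveB dE (is_deriveZ k dX))).
by rewrite /f1 /GRing.scale/=; ring.
Qed.

Let derive_f1 (r : R) : 0 < r -> is_derive r 1 f1 (f2 r).
Proof.
move=> r0; have dE := deriveE r0; have dp := is_derive1_powR eps r0.
have dm : is_derive r 1 (fun r => alpha * (1 + eps) * r `^ eps)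
  (alpha * (1 + eps) * (eps * r `^ (eps - 1))) := is_deriveZ _ dp.
apply: (is_derive_eq (is_deriveB (is_deriveM dm dE)
  (is_deriveZ (2 * k) (is_derive_id r 1)))).
by rewrite /f2 /GRing.scale/=; ring.
Qed.

Let E_ge1 (r : R) : 1 <= E r.
Proof.
by rewrite -expR0 ler_expR mulr_ge0 ?powR_ge0// ltW.
Qed.

(** For [r <= 1] the power [r `^ (eps - 1)] is at least 1, so the first summand
    alone is at least [2 * k]; for [1 <= r] the power [r `^ eps] is at least 1,
    so the second summand alone is. *)
Let f2_ge0 (r : R) : 0 < r -> 0 <= f2 r.
Proof.
move: (alpha_gt0) (eps_gt0) (eps_le1) => al0 ep0 ep1.
move=> r0; have e1 := E_ge1 r; rewrite /f2.
have kl : 2 * k <= alpha * (1 + eps) * eps.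
  have : k <= alpha * (1 + eps) * eps / 2 by rewrite /k ge_min lexx.
  by lra.
have kr : 2 * k <= alpha ^+ 2.
  have : k <= alpha ^+ 2 / 2 by rewrite /k ge_min lexx orbT.
  by lra.
have a1 : alpha <= alpha * (1 + eps) by rewrite mulrDr mulr1 lerDl mulr_ge0// ltW.
have [r1|/ltW r1] := leP r 1.
  have p1 : 1 <= r `^ (eps - 1).
    by rewrite -[leLHS](powRr0 r); apply: ger_powR => /=; [rewrite r0|lra].
  have p2 : 1 <= r `^ (eps - 1) * E r by rewrite mulr_ege1.
  have : alpha * (1 + eps) * eps <= alpha * (1 + eps) * eps * (r `^ (eps - 1) * E r).
    by rewrite ler_peMr// ltW// !mulr_gt0// addr_gt0.
  have : 0 <= (alpha * (1 + eps) * r `^ eps) ^+ 2 * E r.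
    by rewrite mulr_ge0 ?sqr_ge0//; lra.
  by lra.
have p1 : 1 <= r `^ eps.
  by rewrite -[leLHS](powRr0 r) ler_powR// ltW.
have p2 : alpha ^+ 2 <= (alpha * (1 + eps) * r `^ eps) ^+ 2.
  have p3 : alpha <= alpha * (1 + eps) * r `^ eps.
    by rewrite (le_trans a1)// ler_peMr// ltW// mulr_gt0// addr_gt0.
  by nra.
have : (alpha * (1 + eps) * r `^ eps) ^+ 2 <=
       (alpha * (1 + eps) * r `^ eps) ^+ 2 * E r.
  by rewrite ler_peMr// sqr_ge0.
have : 0 <= alpha * (1 + eps) * eps * r `^ (eps - 1) * E r.
  rewrite !mulr_ge0 ?powR_ge0 ?ltW//; first by rewrite addr_gt0.
  by rewrite (lt_le_trans ltr01).
by lra.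
Qed.

(** First-order expansion of the exponential for [r <= 1], where
    [r ^+ 2 <= r `^ (1 + eps)], and second-order one for [1 <= r]. *)
Let h_min (r : R) : 0 < r -> 1 <= h r.
Proof.
move: (alpha_gt0) (eps_gt0) (eps_le1) => al0 ep0 ep1.
move=> r0; rewrite /h.
have kr : k <= alpha ^+ 2 / 2 by rewrite /k ge_min lexx orbT.
have kl : k <= alpha.
  have : k <= alpha * (1 + eps) * eps / 2 by rewrite /k ge_min lexx.
  have : (1 + eps) * eps <= 2 by nra.
  by nra.
have [r1|/ltW r1] := leP r 1.
  have p1 : r ^+ 2 <= r `^ (1 + eps).
    by rewrite -powR_mulrn ?(ltW r0)//; apply: ger_powR => /=; [rewrite r0|lra].
  have := expR_ge1Dx (alpha * r `^ (1 + eps)); rewrite -/(E r).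
  by have := sqr_ge0 r; nra.
have p1 : r <= r `^ (1 + eps) by rewrite le1r_powR// lerDl ltW.
have ar : 0 <= alpha * r `^ (1 + eps) by rewrite mulr_ge0 ?powR_ge0// ltW.
have := expR_ge1Dxn 1 ar; rewrite -/(E r) exprMn (_ : 2`!%:R = 2)//.
have p2 : r ^+ 2 <= (r `^ (1 + eps)) ^+ 2 by nra.
have : alpha ^+ 2 * r ^+ 2 <= alpha ^+ 2 * (r `^ (1 + eps)) ^+ 2.
  by rewrite ler_wpM2l// sqr_ge0.
have : k * r ^+ 2 <= alpha ^+ 2 / 2 * r ^+ 2 by rewrite ler_wpM2r// sqr_ge0.
by lra.
Qed.

Let h_norm (s : R) : h `|s| = expR (alpha * `|s| `^ (1 + eps)) - k * s ^+ 2.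
Proof. by rewrite /h /E real_normK// num_real. Qed.

Let continuous_h_norm : continuous (fun s : R => h `|s|).
Proof.
rewrite (_ : (fun s : R => h `|s|) =
  (fun s => expR (alpha * `|s| `^ (1 + eps)) - k * s ^+ 2)); last first.
  by apply/funext => s; rewrite h_norm.
move=> s; apply: cvgB; first exact: continuous_scalar_cost.
by apply: cvgMr; exact: exprn_continuous.
Qed.

Let continuous_h (a b : R) : 0 <= a -> {within `[a, b], continuous h}.
Proof.
move=> a0; apply: (@subspace_eq_continuous _ _ _ (fun s : R => h `|s|)).
  move=> s; rewrite inE/= in_itv/= => /andP[sa _].
  by rewrite /from_subspace/= ger0_norm// (le_trans a0).
by apply: continuous_subspaceT; exact: continuous_h_norm.
Qed.

Let h_mid (a b : R) : 0 <= a -> a <= b -> h ((a + b) / 2) <= (h a + h b) / 2.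
Proof.
move=> a0 ab; apply: (@midpoint_convex_of_derive2 _ h f1 f2).
- exact: ab.
- exact: continuous_h.
- by move=> x ax xb; apply: derive_h; lra.
- by move=> x ax xb; apply: derive_f1; lra.
- by move=> x ax xb; apply: f2_ge0; lra.
Qed.

Let h0 : h 0 = 1.
Proof.
by rewrite /h /E powR0 ?gt_eqF// ?addr_gt0// expr0n/= !mulr0 expR0 subr0.
Qed.

(** [f1] is nondecreasing, and it takes a nonnegative value left of [c] by the
    mean value theorem, [h] being minimal at 0. *)
Let f1_ge0 (c : R) : 0 < c -> 0 <= f1 c.
Proof.
move=> c0; have [d /[!in_itv]/= /andP[d0 dc] e1] : exists2 d, d \in `]0, c[ &
    h c - h 0 = f1 d * (c - 0).
  apply: (MVT c0) => [x|]; last exact: continuous_h.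
  by rewrite in_itv/= => /andP[x0 _]; exact: derive_h.
have f1d : 0 <= f1 d.
  by rewrite -(@pmulr_lge0 _ c)// -[c in _ * c]subr0 -e1 h0 subr_ge0 h_min.
have [z /[!in_itv]/= /andP[dz zc] e2] : exists2 z, z \in `]d, c[ &
    f1 c - f1 d = f2 z * (c - d).
  apply: (MVT dc) => [x|].
    by rewrite in_itv/= => /andP[dx xc]; apply: derive_f1; lra.
  apply: derivable_within_continuous => x.
  rewrite in_itv/= => /andP[dx xc].
  by apply: (@ex_derive _ _ _ _ _ _ _ (derive_f1 _)); lra.
have : 0 <= f1 c - f1 d by rewrite e2 mulr_ge0 ?f2_ge0 ?subr_ge0 ?ltW//; lra.
by lra.
Qed.

Let h_homo (a b : R) : 0 <= a -> a <= b -> h a <= h b.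
Proof.
move=> a0; rewrite le_eqVlt => /orP[/eqP->//|ab].
have [c /[!in_itv]/= /andP[ac cb] e] : exists2 c, c \in `]a, b[ &
    h b - h a = f1 c * (b - a).
  apply: (MVT ab) => [x|]; last exact: continuous_h.
  by rewrite in_itv/= => /andP[ax _]; apply: derive_h; lra.
by rewrite -subr_ge0 e mulr_ge0 ?f1_ge0 ?subr_ge0 ?ltW//; lra.
Qed.

(** When [eps < 1] the scalar cost has no second derivative at 0.  But
    [s |-> h `|s|] is convex all the same, as the composition of the absolute
    value with a convex nondecreasing function on the half-line; adding back
    [k s^2] contributes the quadratic term. *)
Lemma scalar_cost_strongly_convex : exists2 c : R, 0 < c & forall s t : R,
  expR (alpha * `|(s + t) / 2| `^ (1 + eps)) + c * (s - t) ^+ 2 <=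
  (expR (alpha * `|s| `^ (1 + eps)) + expR (alpha * `|t| `^ (1 + eps))) / 2.
Proof.
exists (k / 4) => [|s t]; first by rewrite divr_gt0.
have : h `|(s + t) / 2| <= (h `|s| + h `|t|) / 2.
  apply: (@le_trans _ _ (h ((`|s| + `|t|) / 2))).
    apply: h_homo => //.
    by rewrite normrM (@ger0_norm _ 2^-1)// ler_pM2r// ler_normD.
  have [st|/ltW ts] := leP `|s| `|t|; first exact: h_mid.
  by rewrite addrC [in leRHS]addrC h_mid.
rewrite !h_norm.
move: (expR _) (expR _) (expR _) => u v w.
have -> : k / 4 * (s - t) ^+ 2 =
    k * s ^+ 2 / 2 + k * t ^+ 2 / 2 - k * ((s + t) / 2) ^+ 2.
  by field.
by lra.
Qed.

End scalar_cost.

(** * The dot product of column vectors *)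

Definition dotv (R : realType) (n : nat) (u v : 'cV[R]_n) : R :=
  (u^T *m v) 0 0.

Section dot_product.
Context {R : realType} {n : nat}.
Implicit Types (u v w : 'cV[R]_n) (a : R).

Lemma dotvE u v : dotv u v = \sum_i u i 0 * v i 0.
Proof. by rewrite /dotv mxE; apply: eq_bigr => i _; rewrite mxE. Qed.

Lemma dotvC u v : dotv u v = dotv v u.
Proof. by rewrite !dotvE; apply: eq_bigr => i _; rewrite mulrC. Qed.

Lemma dotvDl u v w : dotv (u + v) w = dotv u w + dotv v w.
Proof. by rewrite /dotv linearD mulmxDl mxE. Qed.

Lemma dotvNl u w : dotv (- u) w = - dotv u w.
Proof. by rewrite /dotv linearN mulNmx mxE. Qed.

Lemma dotvZl a u w : dotv (a *: u) w = a * dotv u w.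
Proof. by rewrite /dotv linearZ -scalemxAl mxE. Qed.

Lemma dotvDr u v w : dotv w (u + v) = dotv w u + dotv w v.
Proof. by rewrite !(dotvC w) dotvDl. Qed.

Lemma dotvNr u w : dotv w (- u) = - dotv w u.
Proof. by rewrite !(dotvC w) dotvNl. Qed.

Lemma dotvZr a u w : dotv w (a *: u) = a * dotv w u.
Proof. by rewrite !(dotvC w) dotvZl. Qed.

Definition dotv_lin := (dotvDl, dotvDr, dotvNl, dotvNr, dotvZl, dotvZr).

Lemma dotv_ge0 u : 0 <= dotv u u.
Proof. by rewrite dotvE sumr_ge0// => i _; rewrite -expr2 sqr_ge0. Qed.

Lemma sqr_coord_le_dotv u i : u i 0 ^+ 2 <= dotv u u.
Proof.
rewrite dotvE (bigD1 i)//= expr2 lerDl sumr_ge0// => j _.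
by rewrite -expr2 sqr_ge0.
Qed.

Lemma dotv_eq0 u : dotv u u <= 0 -> u = 0.
Proof.
move=> u0; apply/colP => i; rewrite mxE; apply/eqP.
by rewrite -sqrf_eq0 eq_le sqr_ge0 andbT (le_trans (sqr_coord_le_dotv u i)).
Qed.

(** The squared norm of [|v|^2 u - (u . v) v] is [|v|^2] times the difference of
    the two sides. *)
Lemma cauchy_schwarz u v : dotv u v ^+ 2 <= dotv u u * dotv v v.
Proof.
have [v0|v0] := leP (dotv v v) 0.
  by rewrite (dotv_eq0 v0) /dotv !mulmx0 mxE expr0n mulr0.
have := dotv_ge0 (dotv v v *: u - dotv u v *: v).
rewrite !dotv_lin (dotvC v u).
rewrite (_ : _ + _ = dotv v v * (dotv u u * dotv v v - dotv u v ^+ 2)); last by ring.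
by rewrite pmulr_rge0// subr_ge0.
Qed.

(** Projection on the nonnegative orthant is nonexpansive, because truncation
    at 0 is on each coordinate. *)
Lemma pos_part_dist_le u v :
  dotv (pos_part u - pos_part v) (pos_part u - pos_part v) <=
  dotv (u - v) (u - v).
Proof.
rewrite !dotvE; apply: ler_sum => i _; rewrite !mxE -!expr2.
have mono (a b : R) : b <= a -> (Num.max 0 a - Num.max 0 b) ^+ 2 <= (a - b) ^+ 2.
  move=> ba; have : 0 <= Num.max 0 a - Num.max 0 b <= a - b.
    by rewrite !maxEle; case: ifPn; case: ifPn; rewrite -?ltNge; lra.
  by nra.
have [ab|/ltW ba] := leP (u i 0) (v i 0); last exact: mono.
by rewrite -sqrrN opprB -[leRHS]sqrrN opprB; exact: mono.
Qed.

Lemma pos_part_ge0 u i : 0 <= pos_part u i 0.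
Proof. by rewrite mxE le_max lexx. Qed.

(** The variational inequality of the projection on the orthant: the vector
    from [pos_part u] to [u] makes an obtuse angle with the vector from
    [pos_part u] to any point [v] of the orthant. *)
Lemma pos_part_variational u v : (forall i, 0 <= v i 0) ->
  dotv (pos_part u - v) (pos_part u - v) <= dotv (pos_part u - v) (u - v).
Proof.
move=> v0; rewrite -subr_ge0 -dotvNr -dotvDr.
rewrite (_ : u - v - (pos_part u - v) = u - pos_part u); last first.
  by rewrite opprB addrA subrK.
rewrite dotvE sumr_ge0// => i _; rewrite !mxE.
by have := v0 i; rewrite !maxEle; case: ifPn; rewrite -?ltNge; nra.
Qed.

End dot_product.

Section operator_bound.
Context {R : realType} {m n : nat}.
Variable A : 'M[R]_(m, n).

Lemma dotv_mulmx_bound : exists2 K : R, 0 < K &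
  forall v, dotv (A *m v) (A *m v) <= K * dotv v v.
Proof.
exists (1 + \sum_i dotv (row i A)^T (row i A)^T) => [|v].
  by rewrite ltr_pwDl// sumr_ge0// => i _; rewrite dotv_ge0.
rewrite [leLHS]dotvE mulrDl mul1r ler_wpDl ?dotv_ge0// mulr_suml ler_sum// => i _.
rewrite -expr2 (_ : (A *m v) i 0 = dotv (row i A)^T v) ?cauchy_schwarz//.
by rewrite dotvE mxE; apply: eq_bigr => j _; rewrite !mxE.
Qed.

End operator_bound.

(** * Convergence and attained minima for column vectors *)

Lemma cvg_colvec_of_dotv (R : realType) (n : nat) (T : Type) (F : set_system T)
  {FF : Filter F} (x : T -> 'cV[R]_n) (l : 'cV[R]_n) :
  dotv (x t - l) (x t - l) @[t --> F] --> (0 : R) -> x @ F --> l.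
Proof.
move=> xl; apply/cvgrPdist_lt => e e0.
have e20 : 0 < e ^+ 2 by rewrite exprn_gt0.
move/cvgrPdist_lt : xl => /(_ _ e20); apply: filterS => t.
rewrite sub0r normrN ger0_norm ?dotv_ge0// => xt.
rewrite /Num.norm/= mx_normrE; apply/bigmax_ltP; split => // -[i j] _ /=.
rewrite (ord1 j) -(@ltr_pXn2r _ 2)// ?nnegrE ?(ltW e0)//.
rewrite real_normK ?num_real//.
apply: le_lt_trans xt; rewrite -sqrrN.
by apply: le_trans (sqr_coord_le_dotv _ i); rewrite !mxE opprB.
Qed.

Lemma cvg_sum_fun (R : realType) (I : finType) (T : Type) (F : set_system T)
  {FF : Filter F} (g : I -> T -> R) (l : I -> R) :
  (forall i, g i @ F --> l i) -> \sum_i g i t @[t --> F] --> \sum_i l i.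
Proof.
move=> gl; elim: (index_enum I) => [|i s IHs].
  by under eq_cvg do rewrite big_nil; rewrite big_nil; exact: cvg_cst.
by under eq_cvg do rewrite big_cons; rewrite big_cons; exact: cvgD.
Qed.

Lemma cvg_dotv (R : realType) (n : nat) (T : Type) (F : set_system T)
  {FF : Filter F} (g h : T -> 'cV[R]_n) (a b : 'cV[R]_n) :
  g @ F --> a -> h @ F --> b -> dotv (g t) (h t) @[t --> F] --> dotv a b.
Proof.
move=> ga hb; under eq_cvg do rewrite dotvE; rewrite dotvE.
apply: cvg_sum_fun => i; apply: cvgM.
  exact: (cvg_comp _ _ ga (@coord_continuous _ _ _ i 0 a)).
exact: (cvg_comp _ _ hb (@coord_continuous _ _ _ i 0 b)).
Qed.

Lemma continuous_of_dotv_le (R : realType) (m n : nat)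
  (g : 'cV[R]_m -> 'cV[R]_n) (C : R) :
  (forall u v, dotv (g u - g v) (g u - g v) <= C * dotv (u - v) (u - v)) ->
  continuous g.
Proof.
move=> gC v; apply: (@cvg_colvec_of_dotv _ _ _ (nbhs v)).
apply: (@squeeze_cvgr _ (nbhs v) _ R (cst 0) (fun u => C * dotv (u - v) (u - v))).
- by near=> u; rewrite dotv_ge0 gC.
- exact: cvg_cst.
rewrite -[X in _ --> X](mulr0 C); apply: cvgMr.
have -> : 0 = dotv (v - v) (v - v) by rewrite subrr /dotv mulmx0 mxE.
by apply: cvg_dotv; apply: cvgB => //; exact: cvg_cst.
Unshelve. all: end_near. Qed.

Lemma continuous_trmx (R : realType) (m n : nat) :
  continuous (fun v : 'M[R]_(m, n) => v^T).
Proof.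
move=> v A /nbhs_ballP[e e0 eA]; apply/nbhs_ballP; exists e => // w [_ vw].
by apply: eA; split => // i j; rewrite !mxE.
Qed.

(** The sublevel set of [F x0] in [S] is closed and contained in a box, hence
    compact; a minimizer over it is a minimizer over [S].  Boxes are compact by
    [rV_compact], hence the detour through row vectors. *)
Lemma exists_min_of_bounded_sublevel (R : realType) (n : nat)
  (F : 'cV[R]_n -> R) (S : set 'cV[R]_n) (x0 : 'cV[R]_n) (r : 'I_n -> R) :
  continuous F -> closed S -> S x0 ->
  (forall x, S x -> F x <= F x0 -> forall i, `|x i 0| <= r i) ->
  exists2 x, S x & forall y, S y -> F x <= F y.
Proof.
move=> cF cS Sx0 Fr.
pose K := [set v : 'rV[R]_n | S v^T /\ F v^T <= F x0].
have cFt : continuous (fun v : 'rV[R]_n => F v^T).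
  by move=> v; apply: continuous_comp; [exact: continuous_trmx|exact: cF].
have closedK : closed K.
  apply: (@closedI _ [set v : 'rV[R]_n | S v^T] [set v : 'rV[R]_n | F v^T <= F x0]).
    by apply: (@preimage_closed _ _ (fun v : 'rV[R]_n => v^T)) => // v _; exact: continuous_trmx.
  apply: (@preimage_closed _ _ (fun v : 'rV[R]_n => F v^T) [set z : R | z <= F x0]).
    by move=> v _; exact: cFt.
  exact: closed_le.
have compactK : compact K.
  have compactB : compact [set v : 'rV[R]_n | forall i, v ord0 i \in `[- r i, r i]].
    apply: (@rV_compact _ _ (fun i => `[- r i, r i]%classic)) => i.
    exact: segment_compact.
  apply: subclosed_compact closedK compactB _ => v [Sv Fv] i.
  by have := Fr _ Sv Fv i; rewrite mxE in_itv/= ler_norml.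
have [||v + vmin] := @EVT_min_rV R n (fun v => F v^T) K _ compactK.
- by exists x0^T; rewrite /K/= trmxK.
- exact: continuous_subspaceT.
rewrite inE => -[Sv Fv]; exists v^T => // y Sy.
have [yx0|/ltW] := leP (F y) (F x0); last exact: le_trans.
by have := vmin y^T; rewrite inE /K/= trmxK; apply; split.
Qed.

(** A Lyapunov argument: [a] decreases and is bounded below, so its increments,
    which dominate [e], tend to 0. *)
Lemma cvg0_of_descent (R : realType) (a e : nat -> R) :
  (forall t, 0 <= a t) -> (forall t, 0 <= e t) ->
  (forall t, a t.+1 + e t.+1 <= a t) -> e @ \oo --> (0 : R).
Proof.
move=> a0 e0 ae; rewrite -cvg_shiftS.
have ca : cvgn a.
  apply: nonincreasing_is_cvgn.
    apply/nonincreasing_seqP => t; apply: le_trans (ae t).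
    by rewrite lerDl.
  by exists 0 => _ [t _ <-].
apply: (@squeeze_cvgr _ _ _ _ (cst 0) (fun t => a t - a t.+1)).
- by apply: nearW => t; rewrite e0/= lerBrDl ae.
- exact: cvg_cst.
rewrite -(subrr (limn a)); apply: cvgB => //.
by rewrite (@cvg_shiftS _ a).
Qed.

(** * Duality for a strongly convex program with affine constraints *)

Lemma colvec_subE (R : realType) (k : nat) (u v : 'cV[R]_k) i :
  (u - v) i 0 = u i 0 - v i 0.
Proof. by rewrite !mxE. Qed.

Section strongly_convex_program.
Context {R : realType} {n m : nat}.
Variables (f : 'cV[R]_n -> R) (c ell : R) (A : 'M[R]_(m, n)) (b : 'cV[R]_m).
Hypothesis c_gt0 : 0 < c.
Hypothesis f_cont : continuous f.
Hypothesis f_ge : forall x, ell <= f x.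
Hypothesis f_mid : forall x y,
  f (2^-1 *: (x + y)) + c * dotv (x - y) (x - y) <= (f x + f y) / 2.

Definition complementary (nu w : 'cV[R]_m) : Prop :=
  forall i, [/\ 0 <= nu i 0, w i 0 <= 0 & nu i 0 * w i 0 = 0].

Definition affine_lagrangian (nu : 'cV[R]_m) (x : 'cV[R]_n) : R :=
  f x + dotv nu (A *m x - b).

Let minimizes nu x :=
  forall y, affine_lagrangian nu x <= affine_lagrangian nu y.

(** The affine part of the Lagrangian cancels at the midpoint, so the Lagrangian
    inherits the strong convexity of [f]; minimality at [x] bounds its value at
    the midpoint of [x] and [y] from below. *)
Lemma quadratic_growth nu x : minimizes nu x ->
  forall y, affine_lagrangian nu x + 2 * c * dotv (y - x) (y - x) <=
            affine_lagrangian nu y.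
Proof.
move=> xmin y; have := xmin (2^-1 *: (y + x)); have := f_mid y x.
rewrite /affine_lagrangian -scalemxAr mulmxDr !dotv_lin.
by lra.
Qed.

Lemma minimizer_unique nu x y : minimizes nu x -> minimizes nu y -> x = y.
Proof.
move=> xmin ymin; have := quadratic_growth xmin y; have := ymin x => yx gr.
apply/eqP; rewrite eq_sym -subr_eq0; apply/eqP/dotv_eq0.
by move: (c_gt0) => c0; rewrite -(@pmulr_rle0 _ (2 * c)) ?mulr_gt0//; lra.
Qed.

(** Sum of the quadratic growth at [x] for [nu] and at [x'] for [nu']: the values
    of [f] cancel. *)
Lemma minimizers_monotone nu nu' x x' : minimizes nu x -> minimizes nu' x' ->
  dotv (nu' - nu) (A *m (x' - x)) <= - (4 * c * dotv (x' - x) (x' - x)).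
Proof.
move=> xmin x'min; have := quadratic_growth xmin x'.
have := quadratic_growth x'min x.
have -> : dotv (x - x') (x - x') = dotv (x' - x) (x' - x).
  by rewrite -opprB dotvNl dotvNr opprK.
by rewrite /affine_lagrangian mulmxBr !dotv_lin; lra.
Qed.

(** Strong convexity between [x] and 0, with the midpoint value bounded below by
    [ell]. *)
Lemma objective_coercive x : 2 * ell - f 0 + 2 * c * dotv x x <= f x.
Proof.
have := f_mid x 0; have := f_ge (2^-1 *: (x + 0)).
by rewrite subr0 addr0; lra.
Qed.

(** Expansion of [|s u + v|^2 >= 0]; choosing [s] lets a cross term be absorbed
    by a quadratic one. *)
Lemma dotv_young (k : nat) (s : R) (u v : 'cV[R]_k) : 0 < s ->
  - dotv u v <= s / 2 * dotv u u + dotv v v / (2 * s).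
Proof.
move=> s0; have := dotv_ge0 (s *: u + v); rewrite !dotv_lin (dotvC v u) => h.
rewrite -subr_ge0 (_ : _ - _ = (s * (s * dotv u u + dotv u v) +
  (s * dotv u v + dotv v v)) / (2 * s)).
  by rewrite divr_ge0// ?mulr_ge0 ?ltW//; lra.
by field; rewrite gt_eqF.
Qed.

(** The quadratic lower bound on [f] dominates the linear term of the
    Lagrangian, so sublevel sets are bounded. *)
Lemma exists_minimizer nu : exists x, minimizes nu x.
Proof.
have [K K0 AK] := dotv_mulmx_bound A; move: (c_gt0) => c0.
(* At [s = K / (2 c)] the term [|A x|^2 / (2 s)] of [dotv_young] is at most
   [c |x|^2], half of the quadratic lower bound on [f]. *)
pose M := f 0 + K / (4 * c) * dotv nu nu - (2 * ell - f 0).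
have cL : continuous (affine_lagrangian nu).
  move=> x; apply: (@cvgD _ _ _ (nbhs x) _ f (fun x => dotv nu (A *m x - b))).
    exact: f_cont.
  apply: (@cvg_dotv _ _ _ (nbhs x)); first exact: cvg_cst.
  apply: (@cvgB _ _ _ (nbhs x)); last exact: cvg_cst.
  apply: (@continuous_of_dotv_le _ _ _ _ K) => u v.
  by rewrite -mulmxBr AK.
have [| |x _ Lx i|x _ xmin] := @exists_min_of_bounded_sublevel R n (affine_lagrangian nu)
  setT 0 (fun=> 1 + M / c) cL.
- exact: closedT.
- by [].
- have xM : dotv x x <= M / c.
    rewrite ler_pdivlMr//.
    have := objective_coercive x; have s0 : 0 < K / (2 * c) by rewrite divr_gt0 ?mulr_gt0.
    have := dotv_young nu (A *m x) s0.
    have : dotv (A *m x) (A *m x) / (2 * (K / (2 * c))) <= c * dotv x x.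
      rewrite ler_pdivrMr ?mulr_gt0//; last by rewrite invr_gt0 mulr_gt0.
      rewrite (_ : c * dotv x x * _ = K * dotv x x) ?AK//.
      by field; rewrite gt_eqF.
    have e : K / (2 * c) / 2 = K / (4 * c) by field; rewrite gt_eqF.
    move: Lx; rewrite /affine_lagrangian mulmx0 !dotv_lin e /M (_ : dotv nu 0 = 0).
      by lra.
    by rewrite /dotv mulmx0 mxE.
  (* [z <= 1 + z ^+ 2] turns the bound on squares into the box. *)
  have := sqr_coord_le_dotv x i; rewrite -(real_normK (num_real (x i 0))).
  by have := normr_ge0 (x i 0); nra.
- by exists x => y; apply: xmin.
Qed.

Lemma minimizer_lipschitz : exists2 C : R, 0 < C &
  forall nu nu' x x', minimizes nu x -> minimizes nu' x' ->
    dotv (x' - x) (x' - x) <= C * dotv (nu' - nu) (nu' - nu).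
Proof.
have [K K0 AK] := dotv_mulmx_bound A; move: (c_gt0) => c0.
(* Again [dotv_young], at [s = K / (4 c)]: half of the monotonicity term
   absorbs [A (x' - x)]. *)
exists (K / (16 * c ^+ 2)) => [|nu nu' x x' xmin x'min].
  by rewrite divr_gt0// mulr_gt0// exprn_gt0.
have := minimizers_monotone xmin x'min.
have s0 : 0 < K / (4 * c) by rewrite divr_gt0 ?mulr_gt0.
have := dotv_young (nu' - nu) (A *m (x' - x)) s0.
set d := dotv (x' - x) (x' - x); set N := dotv (nu' - nu) (nu' - nu).
have : dotv (A *m (x' - x)) (A *m (x' - x)) / (2 * (K / (4 * c))) <= 2 * c * d.
  rewrite ler_pdivrMr ?mulr_gt0//; last by rewrite invr_gt0 mulr_gt0.
  rewrite (_ : 2 * c * d * _ = K * d) ?AK//.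
  by field; rewrite gt_eqF.
move=> h1 h2 h3.
have : 2 * c * d <= K / (4 * c) / 2 * N by lra.
rewrite -ler_pdivlMl ?mulr_gt0//; congr (_ <= _).
by field; rewrite gt_eqF.
Qed.

Hypothesis slater : exists x, vec_lt (A *m x) b.

(** Evaluating the Lagrangian at the Slater point [xs] shows that, on the orthant,
    [d nu <= f xs - nu . (b - A xs)] with [b - A xs] positive: the points of the
    orthant where [d] is at least [d 0] lie in a box. *)
Lemma exists_dual_maximizer (X : 'cV[R]_m -> 'cV[R]_n) :
  (forall nu, minimizes nu (X nu)) ->
  exists2 nu : 'cV[R]_m, (forall i, 0 <= nu i 0) &
    forall nu' : 'cV[R]_m, (forall i, 0 <= nu' i 0) ->
      affine_lagrangian nu' (X nu') <= affine_lagrangian nu (X nu).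
Proof.
move=> Xmin; have [K K0 AK] := dotv_mulmx_bound A; move: (c_gt0) => c0.
have [C C0 XC] := minimizer_lipschitz.
have [xs xsb] := slater.
have cX : continuous X.
  by apply: (@continuous_of_dotv_le _ _ _ _ C) => u v; exact: XC.
have cd : continuous (fun nu => - affine_lagrangian nu (X nu)).
  move=> nu; apply: (@cvgN _ _ _ (nbhs nu)).
  apply: (@cvgD _ _ _ (nbhs nu) _ (f \o X) (fun nu => dotv nu (A *m X nu - b))).
    by apply: continuous_comp; [exact: cX|exact: f_cont].
  apply: (@cvg_dotv _ _ _ (nbhs nu)) => //.
  apply: (@cvgB _ _ _ (nbhs nu)); last exact: cvg_cst.
  apply: (@continuous_comp _ _ _ X (fun x => A *m x)); first exact: cX.
  apply: (@continuous_of_dotv_le _ _ _ _ K) => u v.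
  by rewrite -mulmxBr AK.
pose S := [set nu : 'cV[R]_m | forall i, 0 <= nu i 0].
pose g := b - A *m xs.
have g0 i : 0 < g i 0 by have := xsb i; rewrite !mxE subr_gt0.
have [| |nu nu0 nule i|nu nu0 numin] := @exists_min_of_bounded_sublevel R m
    _ S 0 (fun i => (f xs - affine_lagrangian 0 (X 0)) / g i 0) cd.
- rewrite (_ : S = \bigcap_(i in setT) [set nu : 'cV[R]_m | 0 <= nu i 0]).
    apply: closed_bigI => i _.
    apply: (@preimage_closed _ _ (fun nu : 'cV[R]_m => nu i 0)
      [set z : R | 0 <= z]) => [v _|]; last exact: closed_ge.
    exact: coord_continuous.
  by apply/seteqP; split => [nu h i _|nu h i]; exact: h.
- by move=> i; rewrite mxE.
- rewrite ger0_norm// ler_pdivlMr//.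
  have := Xmin nu xs; rewrite lerN2 in nule; move/(le_trans nule).
  rewrite {2}/affine_lagrangian -[A *m xs - b]opprB -/g dotvNr.
  suff : nu i 0 * g i 0 <= dotv nu g by lra.
  rewrite dotvE (bigD1 i)//= lerDl sumr_ge0// => j _.
  by rewrite mulr_ge0// ltW.
exists nu => // nu' nu'0.
by have := numin nu' nu'0; rewrite lerN2.
Qed.

(** With [w] the residual at the minimizer for a dual maximizer [nu], maximality
    and the Lipschitz dependence of minimizers give, for every [nu'] in the
    orthant, [(nu' - nu) . w <= D |nu' - nu|^2].  Taking for [nu'] the projection
    of [nu + tau w], the variational inequality bounds the same product below by
    [|nu' - nu|^2 / tau]; with [tau < 1 / D] this forces [nu' = nu], which says
    coordinate by coordinate that [nu] and [w] are complementary. *)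
Lemma exists_saddle_point : exists (nu : 'cV[R]_m) x, minimizes nu x /\
  complementary nu (A *m x - b).
Proof.
have [X Xmin] := choice exists_minimizer.
have [nu nu0 numax] := exists_dual_maximizer Xmin.
have [K K0 AK] := dotv_mulmx_bound A.
have [C C0 XC] := minimizer_lipschitz.
exists nu, (X nu); split => //.
set w := A *m X nu - b.
pose D := (1 + K * C) / 2.
have D0 : 0 < D by rewrite divr_gt0// ltr_pwDl// mulr_ge0// ltW.
(* The dual value at [nu'] exceeds that at [nu] by at least
   [(nu' - nu) . (A (X nu') - b)], which is thus nonpositive; replacing [X nu']
   by [X nu] costs a quadratic error. *)
have wD (nu' : 'cV[R]_m) : (forall i, 0 <= nu' i 0) ->
    dotv (nu' - nu) w <= D * dotv (nu' - nu) (nu' - nu).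
  move=> nu'0; have := numax _ nu'0; have := Xmin nu (X nu').
  have := XC _ _ _ _ (Xmin nu) (Xmin nu').
  have := AK (X nu' - X nu).
  have := dotv_young (nu' - nu) (A *m (X nu' - X nu)) ltr01.
  rewrite /affine_lagrangian => h1 h2 h3 h4 h5.
  have h6 : dotv (nu' - nu) w <= - dotv (nu' - nu) (A *m (X nu' - X nu)).
    move: h4 h5; rewrite /w !mulmxBr !dotv_lin; lra.
  rewrite (le_trans h6)// (le_trans h1)// /D.
  have : K * dotv (X nu' - X nu) (X nu' - X nu) <=
         K * (C * dotv (nu' - nu) (nu' - nu)) by rewrite ler_wpM2l// ltW.
  by lra.
pose tau := (2 * D)^-1.
have tau0 : 0 < tau by rewrite invr_gt0 mulr_gt0.
have fixw : pos_part (nu + tau *: w) = nu.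
  apply/eqP; rewrite -subr_eq0; apply/eqP/dotv_eq0.
  set v := _ - nu.
  have : dotv v v <= dotv v (tau *: w).
    have := pos_part_variational (nu + tau *: w) nu0.
    by rewrite -/v (addrC nu) addrK.
  have := wD _ (pos_part_ge0 (nu + tau *: w)); rewrite -/v dotvZr.
  rewrite -(ler_pM2l tau0) mulrA (_ : tau * D = 2^-1); first by lra.
  by rewrite /tau; field; rewrite gt_eqF.
move=> i; have n0 := nu0 i.
have : Num.max 0 (nu i 0 + tau * w i 0) = nu i 0.
  by rewrite -[in RHS]fixw [in RHS]mxE [in RHS]mxE [in RHS]mxE.
move: (w i 0) (nu i 0) n0 => z a a0.
rewrite maxEle; case: ifPn => [za e|]; last first.
  rewrite -ltNge => za e; rewrite -e in za *.
  by split => //; [nra | rewrite mul0r].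
have -> : z = 0.
  have : tau * z = 0 by lra.
  by move/eqP; rewrite mulf_eq0 gt_eqF//= => /eqP.
by rewrite mulr0.
Qed.

(** At the minimizer the term [nu . (A x - b)] vanishes, at a feasible [y] it is
    nonpositive; quadratic growth of the Lagrangian thus becomes quadratic growth
    of [f] on the feasible set, which also gives uniqueness. *)
Lemma saddle_point_optimal (nu : 'cV[R]_m) x : minimizes nu x ->
  complementary nu (A *m x - b) ->
  argmin [set y | vec_le (A *m y) b] f = [set x].
Proof.
move=> xmin kkt; have nux : dotv nu (A *m x - b) = 0.
  by rewrite dotvE big1// => i _; have [_ _ ->] := kkt i.
have growth y : vec_le (A *m y) b -> f x + 2 * c * dotv (y - x) (y - x) <= f y.
  move=> yb; have := quadratic_growth xmin y; rewrite /affine_lagrangian nux addr0.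
  have : dotv nu (A *m y - b) <= 0.
    rewrite dotvE -oppr_ge0 -sumrN sumr_ge0// => i _.
    have [nu0 _ _] := kkt i.
    by rewrite -mulrN mulr_ge0// oppr_ge0 colvec_subE subr_le0.
  by lra.
have xb : vec_le (A *m x) b.
  by move=> i; have [_ + _] := kkt i; rewrite colvec_subE subr_le0.
apply/seteqP; split => [y [yb ymin]|_ ->].
  apply/eqP; rewrite -subr_eq0; apply/eqP/dotv_eq0.
  have := growth _ yb; have := ymin _ xb; move: (c_gt0) => c0 h1 h2.
  by rewrite -(@pmulr_rle0 _ (2 * c)) ?mulr_gt0//; lra.
split => // y yb; apply: le_trans (growth _ yb).
by rewrite lerDl !mulr_ge0 ?dotv_ge0// ltW.
Qed.

(** The squared distance of the multipliers to [nu], divided by [4 c rho],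
    decreases by at least [|xs t.+1 - x|^2] at each step, whatever the signs of
    the entries of the initial multiplier. *)
Lemma dual_ascent_cvg (nu : 'cV[R]_m) x : minimizes nu x ->
  complementary nu (A *m x - b) ->
  exists2 rhobar : R, 0 < rhobar & forall rho, 0 < rho -> rho <= rhobar ->
    forall (xs : nat -> 'cV[R]_n) (nus : nat -> 'cV[R]_m),
      (forall t, minimizes (nus t) (xs t.+1) /\
         nus t.+1 = pos_part (nus t + rho *: (A *m xs t.+1 - b))) ->
      xs @ \oo --> x.
Proof.
move=> xmin kkt; have [K K0 AK] := dotv_mulmx_bound A; move: (c_gt0) => c0.
exists (4 * c / K) => [|rho rho0 rhoK xs nus step]; first by rewrite divr_gt0 ?mulr_gt0.
(* Complementarity makes [nu] a fixed point of the update at every step size. *)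
have fix_nu : nu = pos_part (nu + rho *: (A *m x - b)).
  apply/colP => i; have [nu0 w0 nuw] := kkt i.
  rewrite [RHS]mxE [X in Num.max _ X]mxE [X in _ + X]mxE.
  move: ((A *m x - b) i 0) (nu i 0) nu0 w0 nuw => w a a0 w0 aw.
  have [->|a_neq0] := eqVneq a 0.
    by rewrite add0r; apply/esym/max_idPl; rewrite pmulr_rle0.
  have -> : w = 0 by move/eqP: aw; rewrite mulf_eq0 (negbTE a_neq0)/= => /eqP.
  by rewrite mulr0 addr0; apply/esym/max_idPr.
apply: cvg_colvec_of_dotv.
pose a t := dotv (nus t - nu) (nus t - nu) / (4 * c * rho).
apply: (@cvg0_of_descent _ a) => t.
- by rewrite divr_ge0 ?dotv_ge0// !mulr_ge0 ?ltW.
- exact: dotv_ge0.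
have [xtmin nut] := step t.
rewrite /a ler_pdivlMr ?mulr_gt0// mulrDl divfK ?gt_eqF ?mulr_gt0//.
rewrite nut {1 2}fix_nu; apply: le_trans (lerD (pos_part_dist_le _ _) (lexx _)) _.
have -> : nus t + rho *: (A *m xs t.+1 - b) - (nu + rho *: (A *m x - b)) =
    (nus t - nu) + rho *: (A *m (xs t.+1 - x)).
  rewrite mulmxBr; move: (A *m xs t.+1) (A *m x) => u v.
  by apply/colP => i; rewrite !mxE; ring.
have := minimizers_monotone xmin xtmin; have := AK (xs t.+1 - x).
set d := dotv (xs t.+1 - x) _; move=> h1 h2.
have -> : forall u v : 'cV[R]_m, dotv (u + rho *: v) (u + rho *: v) =
    dotv u u + 2 * rho * dotv u v + rho * (rho * dotv v v).
  by move=> u v; rewrite !dotv_lin (dotvC v u); ring.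
set p := dotv (nus t - nu) (A *m _) in h2 *.
set v2 := dotv (A *m _) _ in h1 *.
have : rho * v2 <= 4 * c * d.
  have r1 : rho * K <= 4 * c by rewrite -ler_pdivlMr.
  have r2 : rho * v2 <= rho * (K * d) by rewrite ler_pM2l.
  have r3 : rho * K * d <= 4 * c * d by rewrite ler_wpM2r ?dotv_ge0.
  by lra.
move=> r4; have r5 : rho * (rho * v2) <= rho * (4 * c * d) by rewrite ler_pM2l.
have r6 : rho * p <= rho * - (4 * c * d) by rewrite ler_pM2l.
lra.
Qed.

End strongly_convex_program.

(** * The cost and the stacked constraints *)

Section separable_cost.
Context {R : realType} {n : nat}.
Variables (alpha eps : R).
Hypotheses (alpha_gt0 : 0 < alpha) (eps_gt0 : 0 < eps) (eps_le1 : eps <= 1).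

Lemma cost_ge0 (x : 'cV[R]_n) : 0 <= cost alpha eps x.
Proof. by rewrite sumr_ge0// => i _; rewrite expR_ge0. Qed.

Lemma continuous_cost : continuous (@cost R n alpha eps).
Proof.
move=> x; apply: (@cvg_sum_fun _ _ _ (nbhs x)) => i.
apply: (@continuous_comp _ _ _ (fun x : 'cV[R]_n => x i 0)
  (fun s => expR (alpha * `|s| `^ (1 + eps)))).
  exact: coord_continuous.
exact: continuous_scalar_cost.
Qed.

Lemma cost_strongly_convex : exists2 c : R, 0 < c & forall x y : 'cV[R]_n,
  cost alpha eps (2^-1 *: (x + y)) + c * dotv (x - y) (x - y) <=
  (cost alpha eps x + cost alpha eps y) / 2.
Proof.
have [c c0 cP] := scalar_cost_strongly_convex alpha_gt0 eps_gt0 eps_le1.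
exists c => // x y; rewrite dotvE mulr_sumr -!big_split/= mulr_suml.
apply: ler_sum => i _; have := cP (x i 0) (y i 0).
by rewrite !mxE -expr2 [X in `|X|]mulrC.
Qed.

End separable_cost.

Section stacking.
Context {R : realType} {k l : nat}.

Lemma vec_le_col_mx (u u' : 'cV[R]_k) (v v' : 'cV[R]_l) :
  vec_le (col_mx u v) (col_mx u' v') <-> vec_le u u' /\ vec_le v v'.
Proof.
split => [h|[hu hv] i].
  split=> i; [have := h (lshift _ i)|have := h (rshift _ i)].
    by rewrite !col_mxEu.
  by rewrite !col_mxEd.
by case: (split_ordP i) => j ->; rewrite ?col_mxEu ?col_mxEd.
Qed.

Lemma vec_lt_col_mx (u u' : 'cV[R]_k) (v v' : 'cV[R]_l) :
  vec_lt u u' -> vec_lt v v' -> vec_lt (col_mx u v) (col_mx u' v').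
Proof.
by move=> hu hv i; case: (split_ordP i) => j ->; rewrite ?col_mxEu ?col_mxEd.
Qed.

Lemma dotv_col_mx (u u' : 'cV[R]_k) (v v' : 'cV[R]_l) :
  dotv (col_mx u v) (col_mx u' v') = dotv u u' + dotv v v'.
Proof. by rewrite /dotv tr_col_mx mul_row_col mxE. Qed.

Lemma pos_part_col_mx (u : 'cV[R]_k) (v : 'cV[R]_l) :
  pos_part (col_mx u v) = col_mx (pos_part u) (pos_part v).
Proof. by rewrite /pos_part map_col_mx. Qed.

End stacking.

Section two_block_constraints.
Context {R : realType} {n : nat}.
Variables (alpha eps : R) (Q : 'M[R]_n) (QL : 'cV[R]_n) (c p : 'cV[R]_(n + n)).

(** Both blocks of constraints as a single affine system, the loads [QL] being
    moved to the right-hand side. *)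
Definition constraint_mx : 'M[R]_((n + n) + (n + n), n) :=
  col_mx (stackI R n) (stackI R n *m Q).

Definition constraint_bound : 'cV[R]_((n + n) + (n + n)) :=
  col_mx c (p + stackI R n *m QL).

Lemma stack_residual x : constraint_mx *m x - constraint_bound =
  col_mx (stackI R n *m x - c) (stackI R n *m (Q *m x - QL) - p).
Proof.
rewrite /constraint_mx /constraint_bound mul_col_mx opp_col_mx add_col_mx mulmxBr mulmxA.
by congr col_mx; rewrite opprD addrA addrAC.
Qed.

Lemma vec_le_residual k (u v : 'cV[R]_k) : vec_le u v <-> vec_le (u - v) 0.
Proof. by split=> h i; have := h i; rewrite !mxE subr_le0. Qed.

Lemma feasibleE :
  feasible Q QL c p = [set x | vec_le (constraint_mx *m x) constraint_bound].
Proof.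
apply/seteqP; split => x /=.
  move=> [h1 h2]; apply: (vec_le_residual _ _).2; rewrite stack_residual -col_mx0.
  by apply/vec_le_col_mx; split; apply: (vec_le_residual _ _).1.
move/(vec_le_residual _ _).1; rewrite stack_residual -col_mx0 => /vec_le_col_mx[h1 h2].
by split; apply: (vec_le_residual _ _).2.
Qed.

Lemma strictly_feasible_stack x : strictly_feasible Q QL c p x ->
  vec_lt (constraint_mx *m x) constraint_bound.
Proof.
move=> [h1 h2]; rewrite /constraint_mx /constraint_bound mul_col_mx.
apply: vec_lt_col_mx => // i; have := h2 i.
by rewrite mulmxBr mulmxA colvec_subE ltrBlDr [X in _ -> _ < X]mxE.
Qed.

Lemma lagrangianE lambda mu x : lagrangian alpha eps Q QL c p lambda mu x =
  affine_lagrangian (cost alpha eps) constraint_mx constraint_bound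
    (col_mx lambda mu) x.
Proof. by rewrite /affine_lagrangian stack_residual dotv_col_mx addrA. Qed.

End two_block_constraints.

Theorem proposition15 (R : realType) (nl ng : nat)
  (alpha eps : R) (B : 'M[R]_(nl + ng)) (VG : 'cV[R]_ng)
  (QL qmin qmax : 'cV[R]_nl) (VN eta : R)
  (nl_ge1 : (1 <= nl)%N)
  (alpha_gt0 : 0 < alpha) (eps_gt0 : 0 < eps) (eps_le1 : eps <= 1)
  (B_sym : B^T = B)
  (BLL_metzler : metzler (B_LL B))
  (BLL_hurwitz : hurwitz (B_LL B))
  (BLL_connected : graph_connected (B_LL B))
  (VL_neq0 : forall i, open_circuit_voltage B VG i 0 != 0)
  (VN_gt0 : 0 < VN) (eta_gt0 : 0 < eta)
  (slater : exists x : 'cV[R]_nl,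
     strictly_feasible (Q_crit B VG) QL (chi B VG VN eta) (phi qmin qmax) x) :
  exists xopt : 'cV[R]_nl,
    argmin (feasible (Q_crit B VG) QL (chi B VG VN eta) (phi qmin qmax))
      (cost alpha eps) = [set xopt]
    /\ exists rhobar : R, 0 < rhobar /\
      forall rho : R, 0 < rho -> rho <= rhobar ->
      forall lambda0 mu0 : 'cV[R]_(nl + nl),
        (exists (x : nat -> 'cV[R]_nl) (lambda mu : nat -> 'cV[R]_(nl + nl)),
           [/\ lambda 0%N = lambda0, mu 0%N = mu0
             & dual_ascent alpha eps (Q_crit B VG) QL (chi B VG VN eta)
                 (phi qmin qmax) rho x lambda mu])
        /\ forall (x : nat -> 'cV[R]_nl) (lambda mu : nat -> 'cV[R]_(nl + nl)),
             lambda 0%N = lambda0 -> mu 0%N = mu0 ->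
             dual_ascent alpha eps (Q_crit B VG) QL (chi B VG VN eta)
               (phi qmin qmax) rho x lambda mu ->
             x @ \oo --> xopt.
Proof.
have [x0 /strictly_feasible_stack x0b] := slater.
set Q := Q_crit B VG in x0b *; set ch := chi B VG VN eta in x0b *.
set ph := phi qmin qmax in x0b *.
have [c c0 midc] := @cost_strongly_convex R nl _ _ alpha_gt0 eps_gt0 eps_le1.
have contc := @continuous_cost R nl alpha eps eps_gt0.
have ge0c := @cost_ge0 R nl alpha eps.
pose A := constraint_mx Q; pose b := constraint_bound QL ch ph.
have minP nu := exists_minimizer A b c0 contc ge0c midc nu.
have [nu [xopt [xmin kkt]]] :=
  exists_saddle_point c0 contc ge0c midc
    (ex_intro (fun x => @vec_lt R _ (A *m x) b) x0 x0b).
exists xopt; split.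
  rewrite feasibleE; exact: (saddle_point_optimal c0 midc xmin kkt).
have [rhobar rhobar0 cvgx] := dual_ascent_cvg c0 midc xmin kkt.
exists rhobar; split => // rho rho0 rhole lambda0 mu0; split.
  have [X Xmin] := choice minP.
  pose step (s : 'cV[R]_(nl + nl) * 'cV[R]_(nl + nl)) :=
    let x := X (col_mx s.1 s.2) in
    (pos_part (s.1 + rho *: (stackI R nl *m x - ch)),
     pos_part (s.2 + rho *: (stackI R nl *m (Q *m x - QL) - ph))).
  pose s t := iter t step (lambda0, mu0).
  (* The iterate at [t.+1] is computed from the multipliers at [t]; the value at
     0 is arbitrary. *)
  exists (fun t => X (col_mx (s t.-1).1 (s t.-1).2)),
    (fun t => (s t).1), (fun t => (s t).2).
  split => // t; split => //=.
  apply/seteqP; split => [y [_ ymin]|_ ->].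
    apply: (minimizer_unique c0 midc (nu := col_mx (s t).1 (s t).2)) => [z|];
      last exact: Xmin.
    by rewrite -!lagrangianE; exact: ymin.
  by split => // y _; rewrite !lagrangianE; exact: Xmin.
move=> x lambda mu _ _ ascent.
apply: (cvgx rho rho0 rhole x (fun t => col_mx (lambda t) (mu t))) => t.
have [xt lt mt] := ascent t; split.
  have [_ ymin] : argmin setT
      (lagrangian alpha eps Q QL ch ph (lambda t) (mu t)) (x t.+1).
    by rewrite xt.
  by move=> y; rewrite -!lagrangianE; exact: ymin.
by rewrite lt mt stack_residual scale_col_mx add_col_mx pos_part_col_mx.
Qed.
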